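(* Let $0<c\le 1$ and, for $\alpha>1$, let $\boldsymbol{p}(\cdot,\cdot,\alpha):\Delta\to\mathbb{R}^3$ be the quadratic triangular patch described in the context. Put $$\alpha_f=\frac{68-59c^2-12\sqrt{196-175c^2-3c^4}}{91c^2-100},\qquad \alpha_g=\frac{24-3\sqrt{4-3c^2}-4\sqrt{1-c^2}}{3\sqrt{4-3c^2}+8\sqrt{1-c^2}}.$$ Then $\alpha_f$ gives the optimal patch with respect to the simplified radial error, and $\alpha_g$ gives the optimal patch with respect to the radial error; that is, $$\min_{\alpha>1}\ \max_{(u,v)\in\Delta}\Big|\|\boldsymbol{p}(u,v,\alpha)\|^2-1\Big|\ \text{ is attained at }\alpha=\alpha_f,\qquad \min_{\alpha>1}\ \max_{(u,v)\in\Delta}\Big|\|\boldsymbol{p}(u,v,\alpha)\|-1\Big|\ \text{ is attained at }\alpha=\alpha_g.$$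
   Context: $\|\cdot\|$ is the Euclidean norm and $\Delta=\{(u,v)\in\mathbb{R}^2:\ 0\le u,v\le 1,\ v\le 1-u\}$. For $0<c\le 1$ the vertices of an equilateral spherical triangle on the unit sphere are $\boldsymbol{v}_0=(c,0,\sqrt{1-c^2})^T$, $\boldsymbol{v}_1=(-\tfrac12c,\tfrac{\sqrt3}{2}c,\sqrt{1-c^2})^T$, $\boldsymbol{v}_2=(-\tfrac12c,-\tfrac{\sqrt3}{2}c,\sqrt{1-c^2})^T$. The quadratic patch is $\boldsymbol{p}(u,v,\alpha)=\sum_{i+j+k=2}\frac{2!}{i!j!k!}u^iv^j(1-u-v)^k\,\boldsymbol{b}_{i,j,k}$ (with $i,j,k$ nonnegative integers) with control points $\boldsymbol{b}_{2,0,0}=\boldsymbol{v}_0$, $\boldsymbol{b}_{0,2,0}=\boldsymbol{v}_1$, $\boldsymbol{b}_{0,0,2}=\boldsymbol{v}_2$, $\boldsymbol{b}_{1,1,0}=\tfrac{\alpha}{2}(\boldsymbol{v}_0+\boldsymbol{v}_1)$, $\boldsymbol{b}_{0,1,1}=\tfrac{\alpha}{2}(\boldsymbol{v}_1+\boldsymbol{v}_2)$, $\boldsymbol{b}_{1,0,1}=\tfrac{\alpha}{2}(\boldsymbol{v}_0+\boldsymbol{v}_2)$. *)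

(* Defs.v *)
From mathcomp Require Import all_boot all_order all_algebra.
From mathcomp Require Import boolp classical_sets reals.

Set Implicit Arguments.
Unset Strict Implicit.
Unset Printing Implicit Defensive.

Import Order.TTheory GRing.Theory Num.Theory.

Local Open Scope classical_set_scope.
Local Open Scope ring_scope.

(* The norm [`|x|] provided by the library on matrices is the sup norm, hence
   an explicit Euclidean norm. *)
Definition enorm (R : realType) (n : nat) (x : 'cV[R]_n) : R :=
  Num.sqrt (\sum_(i < n) x i 0 ^+ 2).

Definition Delta (R : realType) : set (R * R) :=
  [set w | [/\ 0 <= w.1 <= 1, 0 <= w.2 <= 1 & w.2 <= 1 - w.1]].

Definition vec3 (R : realType) (x y z : R) : 'cV[R]_3 :=
  \col_(i < 3) [:: x; y; z]`_i.

Definition v0 (R : realType) (c : R) : 'cV[R]_3 :=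
  vec3 c 0 (Num.sqrt (1 - c ^+ 2)).

Definition v1 (R : realType) (c : R) : 'cV[R]_3 :=
  vec3 (- (1 / 2 * c)) (Num.sqrt 3 / 2 * c) (Num.sqrt (1 - c ^+ 2)).

Definition v2 (R : realType) (c : R) : 'cV[R]_3 :=
  vec3 (- (1 / 2 * c)) (- (Num.sqrt 3 / 2 * c)) (Num.sqrt (1 - c ^+ 2)).

(* The default value is never used: [patch] only sums over i + j + k = 2. *)
Definition control_point (R : realType) (c alpha : R) (i j k : nat) :
    'cV[R]_3 :=
  match i, j, k with
  | 2%N, 0%N, 0%N => v0 c
  | 0%N, 2%N, 0%N => v1 c
  | 0%N, 0%N, 2%N => v2 c
  | 1%N, 1%N, 0%N => (alpha / 2) *: (v0 c + v1 c)
  | 0%N, 1%N, 1%N => (alpha / 2) *: (v1 c + v2 c)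
  | 1%N, 0%N, 1%N => (alpha / 2) *: (v0 c + v2 c)
  | _, _, _ => 0
  end.

Definition patch (R : realType) (c u v alpha : R) : 'cV[R]_3 :=
  \sum_(i < 3) \sum_(j < 3) \sum_(k < 3 | (i + j + k == 2)%N)
    ((2`!)%:R / (i`! * j`! * k`!)%:R * u ^+ i * v ^+ j * (1 - u - v) ^+ k)
      *: control_point c alpha i j k.

Definition simplified_radial_error (R : realType) (c alpha : R) (w : R * R) :
    R :=
  `| enorm (patch c w.1 w.2 alpha) ^+ 2 - 1 |.

Definition radial_error (R : realType) (c alpha : R) (w : R * R) : R :=
  `| enorm (patch c w.1 w.2 alpha) - 1 |.

Definition alpha_f (R : realType) (c : R) : R :=
  (68 - 59 * c ^+ 2 - 12 * Num.sqrt (196 - 175 * c ^+ 2 - 3 * c ^+ 4))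
    / (91 * c ^+ 2 - 100).

Definition alpha_g (R : realType) (c : R) : R :=
  (24 - 3 * Num.sqrt (4 - 3 * c ^+ 2) - 4 * Num.sqrt (1 - c ^+ 2))
    / (3 * Num.sqrt (4 - 3 * c ^+ 2) + 8 * Num.sqrt (1 - c ^+ 2)).

Definition is_maximum (R : realType) (A : set R) (m : R) : Prop :=
  A m /\ ubound A m.

(* "min over a in A of max over t in D of e a t is attained at a0".  The
   function M is determined on A by its first property, so that the existence
   of all the maxima is part of the claim. *)
Definition minmax_attained_at (R : realType) (T : Type) (A : set R)
    (D : set T) (e : R -> T -> R) (a0 : R) : Prop :=
  exists M : R -> R,
    [/\ forall a, A a -> is_maximum (e a @` D) (M a),
        A a0
      & forall a, A a -> M a0 <= M a].

(* Main.v *)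
(** Write [b = alpha - 1], [x = uv + vw + wu] and [y = uvw] in the barycentric
    coordinates [u, v, w].  Then [||p||^2] is a polynomial in [x] and [y], convex
    quadratic in [x] and decreasing in [y].  With Schur's inequality
    [9y >= 4x - 1] and [y >= 0], convexity bounds it from above by its values at
    a vertex, at an edge midpoint and at the center; with [3y <= x^2] and an
    explicit upper bound on [b], it is bounded from below by its value at the
    center.  At the optimal parameter the errors at the edge midpoint and at the
    center balance.  Both norms increase with [b], so any larger [b] is worse at
    the midpoint and any smaller one is worse at the center. *)

Require Import Defs.
From mathcomp Require Import all_boot all_order all_algebra.
From mathcomp Require Import boolp classical_sets reals.
From mathcomp Require Import topology normedtype realfun derive ring lra.

Import Order.TTheory GRing.Theory Num.Theory.
Import numFieldNormedType.Exports.

Local Open Scope classical_set_scope.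
Local Open Scope ring_scope.

(** * Reduction of the minimax claim to a single threshold *)

(** [E] separates the maximum at [a0] from all the others; choice turns the maxima, which exist for
    each [a] separately, into one function [M]. *)
Lemma minmax_attained_at_bound (R : realType) (T : Type) (A : set R)
    (D : set T) (e : R -> T -> R) (a0 E : R) :
  (forall a, A a -> exists2 t, D t & forall s, D s -> e a s <= e a t) ->
  A a0 -> (forall t, D t -> e a0 t <= E) ->
  (forall a, A a -> exists2 t, D t & E <= e a t) ->
  minmax_attained_at A D e a0.
Proof.
move=> maxA Aa0 leE geE.
have /choice[M maxM] : forall a, exists m, A a -> is_maximum (e a @` D) m.
  move=> a; have [Aa|nAa] := pselect (A a); last by exists 0.
  have [t Dt tmax] := maxA a Aa; exists (e a t) => _; split; first by exists t.
  by move=> _ [s Ds <-]; exact: tmax.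
exists M; split => // a Aa.
have [[t Dt <-] _] := maxM _ Aa0; have [_ ub] := maxM _ Aa.
have [s Ds Es] := geE _ Aa.
apply: le_trans (leE _ Dt) _; apply: le_trans Es _.
by apply: ub; exists s.
Qed.

(** * Schur's inequality and symmetric functions on the triangle *)

Lemma schur_sorted (R : realDomainType) (u v w : R) :
  0 <= w -> w <= v -> v <= u ->
  0 <= u * (u - v) * (u - w) + v * (v - u) * (v - w) + w * (w - u) * (w - v).
Proof.
move=> w0 wv vu.
have -> : u * (u - v) * (u - w) + v * (v - u) * (v - w) + w * (w - u) * (w - v)
  = (u - v) ^+ 2 * (u + v - w) + w * (u - w) * (v - w) by ring.
by rewrite addr_ge0 ?mulr_ge0 ?sqr_ge0 //; lra.
Qed.

Lemma schur (R : realDomainType) (u v w : R) :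
  0 <= u -> 0 <= v -> 0 <= w ->
  0 <= u * (u - v) * (u - w) + v * (v - u) * (v - w) + w * (w - u) * (w - v).
Proof.
move=> u0 v0 w0.
have [vu|/ltW uv] := leP v u; have [wv|/ltW vw] := leP w v;
  have [wu|/ltW uw] := leP w u; try by [
  have := schur_sorted _ u v w; lra | have := schur_sorted _ u w v; lra
| have := schur_sorted _ v u w; lra | have := schur_sorted _ v w u; lra
| have := schur_sorted _ w u v; lra | have := schur_sorted _ w v u; lra].
Qed.

(** [sym2] and [sym3] are elementary symmetric polynomials of the barycentric coordinates, whose sum
    is 1. *)
Definition sym2 {R : realType} (t : R * R) : R :=
  t.1 * t.2 + (t.1 + t.2) * (1 - t.1 - t.2).

Definition sym3 {R : realType} (t : R * R) : R :=
  t.1 * t.2 * (1 - t.1 - t.2).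

Lemma Delta_sym_bounds (R : realType) (t : R * R) : Delta t ->
  [/\ 0 <= sym2 t <= 3^-1, 0 <= sym3 t, 4 * sym2 t - 1 <= 9 * sym3 t
    & 3 * sym3 t <= sym2 t ^+ 2].
Proof.
case: t => u v; rewrite /Delta /sym2 /sym3 /= => -[/andP[u0 _] /andP[v0 _] vu].
have [w wE] : exists w, w = 1 - u - v by exists (1 - u - v).
have w0 : 0 <= w by rewrite wE; lra.
have uv0 := mulr_ge0 u0 v0; have uw0 := mulr_ge0 u0 w0.
have vw0 := mulr_ge0 v0 w0; have uvw0 := mulr_ge0 uv0 w0.
have sq1 := sqr_ge0 (u - v); have sq2 := sqr_ge0 (u - w).
have sq3 := sqr_ge0 (v - w).
have wE' : u = 1 - v - w by rewrite wE; ring.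
rewrite -wE; split => //.
- apply/andP; split; first by lra.
  have : 3 * (u * v + (u + v) * w) <= (u + v + w) ^+ 2 by lra.
  by rewrite wE' (_ : 1 - v - w + v + w = 1) ?expr1n; [lra|ring].
- have := schur _ u v w u0 v0 w0.
  suff -> : u * (u - v) * (u - w) + v * (v - u) * (v - w)
    + w * (w - u) * (w - v) = 1 - 4 * (u * v + (u + v) * w) + 9 * (u * v * w).
    by lra.
  by rewrite wE'; ring.
- have s1 := sqr_ge0 (u * v - u * w); have s2 := sqr_ge0 (u * v - v * w).
  have s3 := sqr_ge0 (u * w - v * w).
  (* The factor [u + v + w = 1] makes both sides quartic; their difference is then half the sum of
     the three squares above. *)
  have -> : 3 * (u * v * w) = 3 * (u * v * w) * (u + v + w).
    by rewrite wE'; ring.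
  by lra.
Qed.

(* [||p||^2] as a function of [a = c^2], [b = alpha - 1], [x = uv + vw + wu] and
   [y = uvw]; the edge midpoints are at [(x, y) = (1/4, 0)], the center is at
   [(1/3, 1/27)]. *)
Definition patch_sqnorm {R : realType} (a b x y : R) : R :=
  1 - 3 * a * x + b * ((4 - 3 * a) * x - 9 * a * y)
    + b ^+ 2 * ((4 - 3 * a) * x ^+ 2 - 3 * a * y).

(** * The norm of the patch in terms of the symmetric functions *)

(** Each mixed control point splits equally between its two vertices, so [v0 c] collects
    [u ^+ 2 + alpha * u * (v + w)] with [v + w = 1 - u]. *)
Lemma patchE (R : realType) (c u v alpha : R) :
  let phi t := t ^+ 2 + alpha * t * (1 - t) in
  patch c u v alpha = phi u *: v0 c + phi v *: v1 c + phi (1 - u - v) *: v2 c.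
Proof.
rewrite /patch /=.
under eq_bigr do under eq_bigr do rewrite big_mkcond !big_ord_recl big_ord0 /=.
rewrite !big_ord_recl !big_ord0 /= /bump /= !factS fact0 /=.
move: (v0 c) (v1 c) (v2 c) => V0 V1 V2.
by apply/colP => i; rewrite !mxE; field.
Qed.

Lemma enorm_patch (R : realType) (c alpha : R) (t : R * R) :
  0 < c -> c <= 1 ->
  enorm (patch c t.1 t.2 alpha)
    = Num.sqrt (patch_sqnorm (c ^+ 2) (alpha - 1) (sym2 t) (sym3 t)).
Proof.
move=> c0 c1; case: t => u v; rewrite /sym2 /sym3 /=.
congr Num.sqrt.
rewrite patchE !big_ord_recl big_ord0 !mxE /=.
have h2 : Num.sqrt (1 - c ^+ 2) ^+ 2 = 1 - c ^+ 2.
  by rewrite sqr_sqrtr // subr_ge0 expr_le1 // ltW.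
have r2 : Num.sqrt 3 ^+ 2 = 3 :> R by rewrite sqr_sqrtr.
move: (Num.sqrt (1 - c ^+ 2)) h2 (Num.sqrt 3) r2 => h h2 r r2.
rewrite /patch_sqnorm.
set p := u ^+ 2 + _; set q := v ^+ 2 + _; set z := (1 - u - v) ^+ 2 + _.
(* Sum of the squared coordinates: [h] and [r] enter only through their known squares. *)
transitivity (c ^+ 2 * ((p - (q + z) / 2) ^+ 2 + r ^+ 2 / 4 * (q - z) ^+ 2)
  + (p + q + z) ^+ 2 * h ^+ 2); first by field.
by rewrite h2 r2 /p /q /z; field.
Qed.

(** * Bounds of the squared norm over the triangle *)

(** The least [y] allowed is 0 for [x <= 1/4] and [(4 * x - 1) / 9] beyond. On each piece the result
    is a convex quadratic in [x], hence lies below its chord. *)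
Lemma patch_sqnorm_le_edge (R : realType) (a b x y m : R) :
  0 <= a -> a <= 1 -> 0 <= b -> 0 <= x <= 3^-1 -> 0 <= y ->
  4 * x - 1 <= 9 * y -> 1 <= m ->
  patch_sqnorm a b 4^-1 0 <= m -> patch_sqnorm a b 3^-1 27^-1 <= m ->
  patch_sqnorm a b x y <= m.
Proof.
move=> a0 a1 b0 /andP[x0 x3] y0 xy m1 Hmid Hcen.
have ab0 := mulr_ge0 a0 b0; have bb0 := mulr_ge0 b0 b0.
have abb0 := mulr_ge0 a0 bb0.
have q0 : 0 <= b ^+ 2 * (4 - 3 * a) by rewrite mulr_ge0 ?sqr_ge0 //; lra.
have decr z : z <= y -> patch_sqnorm a b x y <= patch_sqnorm a b x z.
  move=> zy; rewrite -subr_ge0.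
  have -> : patch_sqnorm a b x z - patch_sqnorm a b x y
    = (9 * (a * b) + 3 * (a * (b * b))) * (y - z) by rewrite /patch_sqnorm; ring.
  by apply: mulr_ge0; lra.
have [xle|/ltW xge] := leP x 4^-1.
  apply: le_trans (decr 0 y0) _.
  (* Chord from the vertex [x = 0], of value 1, to the edge midpoint [x = 1/4]. *)
  have e : (1 - 4 * x) * 1 + 4 * x * patch_sqnorm a b 4^-1 0 - patch_sqnorm a b x 0
      = b ^+ 2 * (4 - 3 * a) * (x * (4^-1 - x)).
    by rewrite /patch_sqnorm; field.
  have : 0 <= b ^+ 2 * (4 - 3 * a) * (x * (4^-1 - x)).
    by rewrite !mulr_ge0 //; lra.
  rewrite -e => {e}.
  have : (1 - 4 * x) * 1 <= (1 - 4 * x) * m by rewrite ler_wpM2l //; lra.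
  have : 4 * x * patch_sqnorm a b 4^-1 0 <= 4 * x * m by rewrite ler_wpM2l //; lra.
  by lra.
apply: le_trans (decr ((4 * x - 1) / 9) _) _; first by lra.
have e : (4 - 12 * x) * patch_sqnorm a b 4^-1 0
    + (12 * x - 3) * patch_sqnorm a b 3^-1 27^-1
    - patch_sqnorm a b x ((4 * x - 1) / 9)
    = b ^+ 2 * (4 - 3 * a) * ((x - 4^-1) * (3^-1 - x)).
  by rewrite /patch_sqnorm; field.
have : 0 <= b ^+ 2 * (4 - 3 * a) * ((x - 4^-1) * (3^-1 - x)).
  by rewrite !mulr_ge0 //; lra.
rewrite -e => {e}.
have : (4 - 12 * x) * patch_sqnorm a b 4^-1 0 <= (4 - 12 * x) * m.
  by rewrite ler_wpM2l //; lra.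
have : (12 * x - 3) * patch_sqnorm a b 3^-1 27^-1 <= (12 * x - 3) * m.
  by rewrite ler_wpM2l //; lra.
by lra.
Qed.

(** Here and at the center the norm is affine in [b]: balancing the norms is a linear equation in
    [b], balancing their squares a quadratic one. *)
Lemma patch_sqnorm_edgeE (R : realType) (h b : R) :
  patch_sqnorm (1 - h ^+ 2) b 4^-1 0 = (1 + 3 * h ^+ 2) * (2^-1 + b / 4) ^+ 2.
Proof. by rewrite /patch_sqnorm; field. Qed.

Lemma patch_sqnorm_centerE (R : realType) (h b : R) :
  patch_sqnorm (1 - h ^+ 2) b 3^-1 27^-1 = h ^+ 2 * (1 + 2 / 3 * b) ^+ 2.
Proof. by rewrite /patch_sqnorm; field. Qed.

(* [42 (1 - h) / (3 + 25 h)] is what the formula for [alpha_g c - 1] becomes when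
   [sqrt (1 + 3 h^2)] is replaced by its tangent [(1 + 3 h) / 2] at [h = 1]. *)
Lemma center_norm_le1 (R : realType) (h b : R) :
  0 <= h -> b * (3 + 25 * h) <= 42 * (1 - h) -> h * (1 + 2 / 3 * b) <= 1.
Proof.
move=> h0 hb; have k0 : 0 < 3 + 25 * h by lra.
rewrite -(ler_pM2r k0).
have : h * (b * (3 + 25 * h)) <= h * (42 * (1 - h)) by rewrite ler_wpM2l.
(* The slack that remains is [3 * (1 - h) ^+ 2]. *)
by have := sqr_ge0 (1 - h); lra.
Qed.

Lemma patch_sqnorm_ge_center (R : realType) (h b x y : R) :
  0 <= h -> h < 1 -> 0 <= b -> b * (3 + 25 * h) <= 42 * (1 - h) ->
  0 <= x <= 3^-1 -> 3 * y <= x ^+ 2 ->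
  patch_sqnorm (1 - h ^+ 2) b 3^-1 27^-1 <= patch_sqnorm (1 - h ^+ 2) b x y.
Proof.
move=> h0 h1 b0 hb /andP[x0 x3] yx.
have k0 : 0 < 3 + 25 * h by lra.
have hh1 : h ^+ 2 <= 1 by rewrite expr_le1 // ltW.
(* On the curve [y = x ^+ 2 / 3], which contains the center, the squared norm is
   [1 + P * x + Q * x ^+ 2]. Its secant slope from [x = 0] to [1/3] is [P + Q / 3], its derivative
   at [1/3] is [P + 2 / 3 * Q]. *)
pose P := - 3 * (1 - h ^+ 2) + b * (1 + 3 * h ^+ 2).
pose Q := - 3 * (1 - h ^+ 2) * b + 4 * h ^+ 2 * b ^+ 2.
have cen : P + Q / 3 <= 0.
  have -> : P + Q / 3 = 3 * ((h * (1 + 2 / 3 * b)) ^+ 2 - 1).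
    by rewrite /P /Q; field.
  have := center_norm_le1 _ _ _ h0 hb.
  rewrite -(@expr_le1 _ 2) //; first by lra.
  by rewrite mulr_ge0 //; lra.
have slope : P + 2 / 3 * Q <= 0.
  pose k := 3 + 25 * h; pose D := 42 * (1 - h); pose d := b * k.
  have D0 : 0 < D by rewrite /D; lra.
  have d0 : 0 <= d by rewrite mulr_ge0 // ltW.
  (* [f] is convex, so its sign at [d] follows from its signs at [0] and [D] *)
  pose f z := 8 * h ^+ 2 * z ^+ 2 + 3 * (5 * h ^+ 2 - 1) * z * k
    - 9 * (1 - h ^+ 2) * k ^+ 2.
  have fd : f d = 3 * k ^+ 2 * (P + 2 / 3 * Q) by rewrite /f /d /P /Q; field.
  have fD : f D <= 0.
    have -> : f D = - ((1 - h) ^+ 2 * (3987 * (h * (1 - h)) + 1053 * h + 459)).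
      by rewrite /f /D /k; ring.
    rewrite oppr_le0 mulr_ge0 ?sqr_ge0 //.
    have hh0 : 0 <= h * (1 - h) by rewrite mulr_ge0 //; lra.
    by lra.
  have f0 : f 0 <= 0.
    have -> : f 0 = - (9 * (1 - h ^+ 2) * k ^+ 2) by rewrite /f; ring.
    by rewrite oppr_le0 mulr_ge0 ?sqr_ge0 // mulr_ge0 // subr_ge0.
  have fconv : D * f d = d * f D + (D - d) * f 0
      - 8 * h ^+ 2 * d * D * (D - d) by rewrite /f; ring.
  have Dd : 0 <= D - d by rewrite subr_ge0.
  have fd0 : f d <= 0.
    rewrite -(pmulr_rle0 _ D0) fconv.
    have := mulr_ge0_le0 d0 fD; have := mulr_ge0_le0 Dd f0.
    have t0 : 0 <= 8 * h ^+ 2 * d * D * (D - d).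
      rewrite (mulr_ge0 (mulr_ge0 (mulr_ge0 _ d0) (ltW D0)) Dd) //.
      by rewrite mulr_ge0 ?sqr_ge0.
    by lra.
  move: fd0; rewrite fd pmulr_rle0 //.
  by rewrite mulr_gt0 // exprn_gt0.
have low : patch_sqnorm (1 - h ^+ 2) b x (x ^+ 2 / 3)
    <= patch_sqnorm (1 - h ^+ 2) b x y.
  rewrite -subr_ge0.
  have -> : patch_sqnorm (1 - h ^+ 2) b x y
    - patch_sqnorm (1 - h ^+ 2) b x (x ^+ 2 / 3)
    = (1 - h ^+ 2) * (9 * b + 3 * b ^+ 2) * (x ^+ 2 / 3 - y).
    by rewrite /patch_sqnorm; field.
  have bb := sqr_ge0 b.
  by rewrite !mulr_ge0 //; lra.
apply: le_trans low; rewrite -subr_ge0.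
(* The secant slope between [x] and [1/3] is a convex combination of the two slopes bounded
   above. *)
have -> : patch_sqnorm (1 - h ^+ 2) b x (x ^+ 2 / 3)
    - patch_sqnorm (1 - h ^+ 2) b 3^-1 27^-1
  = (3^-1 - x) * ((1 - 3 * x) * - (P + Q / 3)
                  + 3 * x * - (P + 2 / 3 * Q)).
  by rewrite /patch_sqnorm /P /Q; field.
by apply: mulr_ge0; [lra | apply: addr_ge0; apply: mulr_ge0; lra].
Qed.

(** * Compactness and continuity, for the existence of the maxima *)

Lemma compact_Delta (R : realType) : compact (@Delta R).
Proof.
have fst_cts : continuous (fun w : R * R => w.1) by move=> w; exact: cvg_fst.
have snd_cts : continuous (fun w : R * R => w.2) by move=> w; exact: cvg_snd.
apply: (subclosed_compact _
  (compact_setX (@segment_compact R 0 1) (@segment_compact R 0 1))).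
- have -> : @Delta R = [set w | 0 <= w.1] `&` [set w | w.1 <= 1]
    `&` [set w | 0 <= w.2] `&` [set w | w.2 <= 1] `&` [set w | 0 <= 1 - w.1 - w.2].
    apply/seteqP; split => w; rewrite /Delta /=.
      by move=> [/andP[? ?] /andP[? ?] ?]; do !split => //; lra.
    by move=> [[[[? ?] ?] ?] ?]; split; [apply/andP..|lra].
  do !apply: closedI.
  + by move/continuous_closedP: fst_cts => /(_ [set x | 0 <= x]); apply; exact: closed_ge.
  + by move/continuous_closedP: fst_cts => /(_ [set x | x <= 1]); apply; exact: closed_le.
  + by move/continuous_closedP: snd_cts => /(_ [set x | 0 <= x]); apply; exact: closed_ge.
  + by move/continuous_closedP: snd_cts => /(_ [set x | x <= 1]); apply; exact: closed_le.
  + have /continuous_closedP : continuous (fun w : R * R => 1 - w.1 - w.2).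
      move=> w; apply: cvgB; last exact: snd_cts.
      by apply: cvgB; [exact: cvg_cst|exact: fst_cts].
    by move=> /(_ [set x | 0 <= x]); apply; exact: closed_ge.
- by move=> w [/andP[? ?] /andP[? ?] _]; split; rewrite /= in_itv /=; apply/andP.
Qed.

Lemma continuous_enorm_patch (R : realType) (c alpha : R) :
  0 < c -> c <= 1 ->
  continuous (fun t : R * R => enorm (patch c t.1 t.2 alpha)).
Proof.
move=> c0 c1.
have -> : (fun t : R * R => enorm (patch c t.1 t.2 alpha)) = fun t =>
    Num.sqrt (patch_sqnorm (c ^+ 2) (alpha - 1) (sym2 t) (sym3 t)).
  by apply/funext => t; exact: enorm_patch.
move=> t.
have f1 : {for t, continuous (fun t : R * R => t.1)} by exact: cvg_fst.
have f2 : {for t, continuous (fun t : R * R => t.2)} by exact: cvg_snd.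
have w : {for t, continuous (fun t : R * R => 1 - t.1 - t.2)}.
  by apply: cvgB => //; apply: cvgB => //; exact: cvg_cst.
have e2 : {for t, continuous (@sym2 R)}.
  by apply: cvgD; apply: cvgM => //; apply: cvgD.
have e3 : {for t, continuous (@sym3 R)}.
  by apply: cvgM => //; apply: cvgM.
have e22 : {for t, continuous (fun t => sym2 t ^+ 2)} by exact: (cvgM e2 e2).
apply: (continuous_comp (f := fun t => patch_sqnorm _ _ (sym2 t) (sym3 t))
  (g := Num.sqrt)); last exact: sqrt_continuous.
rewrite /patch_sqnorm.
have scal (k : R) (f : R * R -> R) : {for t, continuous f} ->
    {for t, continuous (fun t => k * f t)}.
  by move=> cf; apply: cvgM => //; exact: cvg_cst.
apply: cvgD.
  apply: cvgD; first by apply: cvgB; [exact: cvg_cst|exact: (scal _ _ e2)].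
  by apply: (scal); apply: cvgB; [exact: (scal _ _ e2)|exact: (scal _ _ e3)].
by apply: (scal); apply: cvgB; [exact: (scal _ _ e22)|exact: (scal _ _ e3)].
Qed.

(** * Equioscillation between the edge midpoint and the center *)

Lemma enorm_patch_edge (R : realType) (c alpha : R) :
  0 < c -> c <= 1 -> 1 < alpha ->
  enorm (patch c 2^-1 2^-1 alpha)
    = Num.sqrt (4 - 3 * c ^+ 2) * (2^-1 + (alpha - 1) / 4).
Proof.
move=> c0 c1 al; have := enorm_patch _ c alpha (2^-1, 2^-1) c0 c1.
have c21 : c ^+ 2 <= 1 by rewrite expr_le1 // ltW.
move=> /= ->; rewrite -[RHS]ger0_norm -?sqrtr_sqr; last first.
  by rewrite mulr_ge0 ?sqrtr_ge0 //; lra.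
congr Num.sqrt; rewrite exprMn sqr_sqrtr; last by lra.
by rewrite /patch_sqnorm /sym2 /sym3 /=; field.
Qed.

Lemma enorm_patch_center (R : realType) (c alpha : R) :
  0 < c -> c <= 1 -> 1 < alpha ->
  enorm (patch c 3^-1 3^-1 alpha)
    = Num.sqrt (1 - c ^+ 2) * (1 + 2 / 3 * (alpha - 1)).
Proof.
move=> c0 c1 al; have := enorm_patch _ c alpha (3^-1, 3^-1) c0 c1.
have c21 : c ^+ 2 <= 1 by rewrite expr_le1 // ltW.
move=> /= ->; rewrite -[RHS]ger0_norm -?sqrtr_sqr; last first.
  by rewrite mulr_ge0 ?sqrtr_ge0 //; lra.
congr Num.sqrt; rewrite exprMn sqr_sqrtr; last by lra.
by rewrite /patch_sqnorm /sym2 /sym3 /=; field.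
Qed.

(** Serves both errors, with [g] the square or the identity. The two values of [g] sum to 2 exactly
    when the excess over 1 at the midpoint equals the deficit at the center. *)
Lemma minmax_equioscillation (R : realType) (c a0 : R) (g : R -> R) :
  let h := Num.sqrt (1 - c ^+ 2) in let s := Num.sqrt (4 - 3 * c ^+ 2) in
  0 < c -> c <= 1 -> continuous g -> g 1 = 1 ->
  (forall x y, 0 <= x -> x < y -> g x < g y) ->
  1 < a0 -> (a0 - 1) * (3 + 25 * h) <= 42 * (1 - h) ->
  g (s * (2^-1 + (a0 - 1) / 4)) + g (h * (1 + 2 / 3 * (a0 - 1))) = 2 ->
  minmax_attained_at [set alpha | 1 < alpha] (@Delta R)
    (fun alpha t => `|g (enorm (patch c t.1 t.2 alpha)) - 1|) a0.
Proof.
move=> h s c0 c1 gcts g1 ghomo a01 a0h gE.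
have c20 : 0 < c ^+ 2 by rewrite exprn_gt0.
have c21 : c ^+ 2 <= 1 by rewrite expr_le1 // ltW.
have gle x y : 0 <= x -> x <= y -> g x <= g y.
  by move=> x0; rewrite le_eqVlt => /predU1P[->//|xy]; rewrite ltW ?ghomo.
have h0 : 0 <= h by exact: sqrtr_ge0.
have s0 : 0 <= s by exact: sqrtr_ge0.
have h1 : h < 1 by rewrite -[ltRHS]sqrtr1 ltr_sqrt //; lra.
have h2 : c ^+ 2 = 1 - h ^+ 2 by rewrite sqr_sqrtr; lra.
have s2 : s ^+ 2 = 1 + 3 * h ^+ 2 by rewrite !sqr_sqrtr; lra.
have edgeE := enorm_patch_edge _ c _ c0 c1.
have cenE := enorm_patch_center _ c _ c0 c1.
have Dedge : Delta (2^-1 : R, 2^-1 : R) by rewrite /Delta /=; split; lra.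
have Dcen : Delta (3^-1 : R, 3^-1 : R) by rewrite /Delta /=; split; lra.
set m0 := s * _ in gE; set k0 := h * _ in gE.
have k00 : 0 <= k0 by rewrite mulr_ge0 //; lra.
have m00 : 0 <= m0 by rewrite mulr_ge0 //; lra.
have k01 : k0 <= 1 by exact: center_norm_le1.
have gk1 : g k0 <= 1 by rewrite -[leRHS]g1 gle.
(* Otherwise [g m0 < 1], and with [g k0 <= 1] the sum could not reach 2. *)
have m01 : 1 <= m0.
  by rewrite leNgt; apply/negP => m1; have := ghomo _ _ m00 m1; lra.
apply: (@minmax_attained_at_bound _ _ _ _ _ _ (g m0 - 1)) => //.
- move=> a _; pose f (t : R * R) := `|g (enorm (patch c t.1 t.2 a)) - 1|.
  have [| |x xD xmax] := @compact_EVT_max _ _ f _ _ (compact_Delta R).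
  + by exists (2^-1, 2^-1).
  + apply: continuous_subspaceT => t.
    apply: cvg_norm; apply: cvgB; last exact: cvg_cst.
    apply: (continuous_comp (f := fun t : R * R => enorm (patch c t.1 t.2 a))).
      exact: continuous_enorm_patch.
    exact: gcts.
  + exists x; first exact: set_mem.
    by move=> t tD; apply: xmax; exact: mem_set.
- move=> t /Delta_sym_bounds[x03 y0 xy yx].
  have b0 : 0 <= a0 - 1 by lra.
  have m0E : patch_sqnorm (c ^+ 2) (a0 - 1) 4^-1 0 = m0 ^+ 2.
    by rewrite h2 patch_sqnorm_edgeE exprMn s2.
  have k0E : patch_sqnorm (c ^+ 2) (a0 - 1) 3^-1 27^-1 = k0 ^+ 2.
    by rewrite h2 patch_sqnorm_centerE exprMn.
  have up : enorm (patch c t.1 t.2 a0) <= m0.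
    rewrite enorm_patch // -(ger0_norm m00) -sqrtr_sqr ler_wsqrtr //.
    apply: patch_sqnorm_le_edge => //; first exact: ltW.
    + by rewrite expr_ge1.
    + by rewrite m0E.
    + by rewrite k0E lerXn2r // (le_trans k01).
  have low : k0 <= enorm (patch c t.1 t.2 a0).
    rewrite enorm_patch // -(ger0_norm k00) -sqrtr_sqr ler_wsqrtr //.
    by rewrite -k0E h2; exact: patch_sqnorm_ge_center.
  have := gle _ _ k00 low; have := gle _ _ (le_trans k00 low) up.
  by rewrite ler_norml; lra.
- move=> a /= a1; have [aa|aa] := leP a0 a.
  + exists (2^-1, 2^-1) => //=.
    apply: le_trans (ler_norm _); rewrite lerD2r edgeE //.
    by rewrite gle // ler_wpM2l //; lra.
  + exists (3^-1, 3^-1) => //=.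
    rewrite distrC; apply: le_trans (ler_norm _); rewrite cenE //.
    have : g (h * (1 + 2 / 3 * (a - 1))) <= g k0.
      by apply: gle; [rewrite mulr_ge0 //; lra | rewrite ler_wpM2l //; lra].
    by rewrite -/h; lra.
Qed.

(** * The two explicit parameters *)

Lemma alpha_g_spec (R : realType) (c : R) :
  let h := Num.sqrt (1 - c ^+ 2) in let s := Num.sqrt (4 - 3 * c ^+ 2) in
  let b := alpha_g c - 1 in
  0 < c -> c <= 1 ->
  [/\ 0 < b, b * (3 + 25 * h) <= 42 * (1 - h)
    & s * (2^-1 + b / 4) + h * (1 + 2 / 3 * b) = 2].
Proof.
move=> h s b c0 c1.
have c20 : 0 < c ^+ 2 by rewrite exprn_gt0.
have c21 : c ^+ 2 <= 1 by rewrite expr_le1 // ltW.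
have h0 : 0 <= h by exact: sqrtr_ge0.
have h1 : h < 1 by rewrite -[ltRHS]sqrtr1 ltr_sqrt //; lra.
have h2 : h ^+ 2 = 1 - c ^+ 2 by rewrite sqr_sqrtr; lra.
have s2 : s ^+ 2 = 4 - 3 * c ^+ 2 by rewrite sqr_sqrtr; lra.
have s00 : 0 <= s by exact: sqrtr_ge0.
have slt : s < 2 by rewrite -(@ltr_pXn2r _ 2) // ?nnegrE // s2; lra.
(* tangent bound at [h = 1] for [s = sqrt (1 + 3 h^2)], convex in [h] *)
have sge : (1 + 3 * h) / 2 <= s.
  rewrite -(@ler_pXn2r _ 2) // ?nnegrE //; last by lra.
  by rewrite s2; have := sqr_ge0 (1 - h); lra.
have d0 : 0 < 3 * s + 8 * h by lra.
have bE : b * (3 * s + 8 * h) = 24 - 6 * s - 12 * h.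
  by rewrite /b /alpha_g -/h -/s; field; rewrite gt_eqF.
have b0 : 0 < b by rewrite -(pmulr_lgt0 _ d0) bE; lra.
split => //; last by lra.
(* The tangent bound is used on both sides of [bE], and the result is doubled. *)
have : b * ((1 + 3 * h) / 2) <= b * s by rewrite ler_wpM2l // ltW.
by lra.
Qed.

(** Times 144, the balance equation is the quadratic called [key] below, without its extra factor;
    its roots have opposite signs and [b] is the positive one. *)
Lemma alpha_f_spec (R : realType) (c : R) :
  let h := Num.sqrt (1 - c ^+ 2) in let s := Num.sqrt (4 - 3 * c ^+ 2) in
  let b := alpha_f c - 1 in
  0 < c -> c <= 1 ->
  0 < b /\ (s * (2^-1 + b / 4)) ^+ 2 + (h * (1 + 2 / 3 * b)) ^+ 2 = 2.
Proof.
move=> h s b c0 c1.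
have c20 : 0 < c ^+ 2 by rewrite exprn_gt0.
have c21 : c ^+ 2 <= 1 by rewrite expr_le1 // ltW.
have h2 : h ^+ 2 = 1 - c ^+ 2 by rewrite sqr_sqrtr; lra.
have s2 : s ^+ 2 = 4 - 3 * c ^+ 2 by rewrite sqr_sqrtr; lra.
have c4 : c ^+ 4 = c ^+ 2 * c ^+ 2 by ring.
have c41 : c ^+ 2 * c ^+ 2 <= c ^+ 2 by rewrite ler_piMl // ltW.
rewrite !exprMn h2 s2 /b /alpha_f c4.
move: (c ^+ 2) c20 c21 c41 => a a0 a1 aa.
set q := Num.sqrt _.
have q0 : 0 <= q by exact: sqrtr_ge0.
have q2 : q ^+ 2 = 196 - 175 * a - 3 * (a * a) by rewrite sqr_sqrtr; lra.
have den : 91 * a - 100 < 0 by lra.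
have den0 : 91 * a - 100 != 0 by rewrite lt_eqF.
(* The signs are flipped to make the denominator positive. *)
have -> : (68 - 59 * a - 12 * q) / (91 * a - 100) - 1
  = (12 * q - (168 - 150 * a)) / (100 - 91 * a).
  by field; rewrite den0 /=; rewrite gt_eqF //; lra.
split.
  rewrite divr_gt0 ?subr_gt0 //; last by lra.
  suff : 14 - 25 / 2 * a < q by lra.
  rewrite -(@ltr_pXn2r _ 2) // ?nnegrE //; last by lra.
  rewrite q2; lra.
have den1 : 100 - 91 * a != 0 by rewrite gt_eqF //; lra.
set b' := _ / (100 - 91 * a).
have bE : b' * (100 - 91 * a) = 12 * q - (168 - 150 * a) by rewrite divfK.
have key : (100 - 91 * a) * ((100 - 91 * a) * b' ^+ 2
    + 12 * (28 - 25 * a) * b' - 252 * a) = 0.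
  transitivity ((b' * (100 - 91 * a) + (168 - 150 * a)) ^+ 2
    - 144 * (196 - 175 * a - 3 * (a * a))); first by ring.
  by rewrite bE -q2; ring.
move/eqP: key; rewrite mulf_eq0 (negbTE den1) /= => /eqP key.
by lra.
Qed.

(** Carries the upper bound on [b] over from [alpha_g] to [alpha_f]. Two norms with sum 2 have
    squares with sum at least 2, the value reached at [alpha_f], and both norms grow with the
    parameter. *)
Lemma alpha_f_le_alpha_g (R : realType) (c : R) :
  0 < c -> c <= 1 -> alpha_f c <= alpha_g c.
Proof.
move=> c0 c1; rewrite leNgt; apply/negP => gf.
have [bg0 _] := alpha_g_spec _ c c0 c1; have [bf0] := alpha_f_spec _ c c0 c1.
have c21 : c ^+ 2 <= 1 by rewrite expr_le1 // ltW.
set h := Num.sqrt (1 - _); set s := Num.sqrt (4 - _).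
have h0 : 0 <= h by exact: sqrtr_ge0.
have s0 : 0 < s by rewrite sqrtr_gt0; lra.
set mf := s * _; set kf := h * _; set mg := s * _; set kg := h * _ => ef eg.
have mg0 : 0 <= mg by rewrite mulr_ge0 //; [exact: ltW|lra].
have kg0 : 0 <= kg by rewrite mulr_ge0 //; lra.
have m : mg < mf by rewrite ltr_pM2l //; lra.
have k : kg <= kf by rewrite ler_wpM2l //; lra.
have : mg ^+ 2 < mf ^+ 2 by rewrite ltr_pXn2r // ?nnegrE // (le_trans mg0) ?ltW.
have : kg ^+ 2 <= kf ^+ 2 by rewrite lerXn2r // ?nnegrE // (le_trans kg0).
have -> : kg = 2 - mg by lra.
(* [mg ^+ 2 + (2 - mg) ^+ 2 = 2 + 2 * (1 - mg) ^+ 2]. *)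
by have := sqr_ge0 (1 - mg); lra.
Qed.

Theorem mainTheorem1 (R : realType) (c : R) (hc0 : 0 < c) (hc1 : c <= 1) :
  minmax_attained_at [set alpha : R | 1 < alpha] (@Delta R)
    (simplified_radial_error c) (alpha_f c) /\
  minmax_attained_at [set alpha : R | 1 < alpha] (@Delta R)
    (radial_error c) (alpha_g c).
Proof.
have [bg0 bgh bgE] := alpha_g_spec _ c hc0 hc1.
have [bf0 bfE] := alpha_f_spec _ c hc0 hc1.
split.
  apply: (minmax_equioscillation _ _ _ (fun x => x ^+ 2)) => //.
  - exact: exprn_continuous.
  - exact: expr1n.
  - by move=> x y x0 xy; rewrite ltr_pXn2r // nnegrE // (le_trans x0) // ltW.
  - by rewrite -subr_gt0.
  - apply: le_trans bgh; rewrite ler_wpM2r //.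
      by rewrite addr_ge0 // mulr_ge0 // sqrtr_ge0.
    by rewrite lerD2r alpha_f_le_alpha_g.
apply: (minmax_equioscillation _ _ _ id) => //.
- by move=> x; exact: cvg_id.
- by rewrite -subr_gt0.
Qed.
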